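(* Let $G=(V,E)$ be a finite simple connected undirected graph on $n$ vertices ($n$ even) with cut parameter $\alpha$, and consider the generalized random shortest path metric on $G$. Let $\mathsf{GR}$ be the cost of the perfect matching computed by the greedy matching heuristic. Then $\mathbb{E}[\mathsf{GR}]=O(1/\alpha)$.
   Context: Generalized random shortest path metric on $G$: each edge $e\in E$ independently receives a weight $w(e)\sim\mathrm{Exp}(1)$, and $d(u,v)$ is the minimum total weight of a $u$–$v$ path in $G$. Cut parameters: for $\varnothing\neq U\subsetneq V$ let $\delta(U)$ be the set of edges with exactly one endpoint in $U$ and $\mu_U=|U|(n-|U|)$; $\alpha=\min_U|\delta(U)|/\mu_U$, $\beta=\max_U|\delta(U)|/\mu_U$. Greedy matching heuristic: repeatedly add to the matching a pair of unmatched vertices with minimum distance $d$; the cost is the sum of $d$ over matched pairs. The $O$-constant is absolute (independent of $G$ and $n$). *)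

(* Defs.v *)
From mathcomp Require Import all_boot all_order all_algebra.
From mathcomp Require Import all_classical all_reals all_analysis.

Set Implicit Arguments.
Unset Strict Implicit.
Unset Printing Implicit Defensive.

Import Order.TTheory GRing.Theory Num.Theory.
Local Open Scope ring_scope.

(* A finite graph is given by its adjacency relation e on the finite vertex
   type V; the edge joining x and y is the unordered pair [set x; y]. *)

Definition simple_graph (V : finType) (e : rel V) : Prop :=
  symmetric e /\ irreflexive e.

Definition connected_graph (V : finType) (e : rel V) : Prop :=
  (0 < #|V|)%N /\ forall x y : V, connect e x y.

Definition edges (V : finType) (e : rel V) : {set {set V}} :=
  [set [set p.1; p.2] | p : V * V & e p.1 p.2].

Definition edge_cut (V : finType) (e : rel V) (U : {set V}) : {set {set V}} :=
  [set f in edges e | #|f :&: U| == 1%N].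

Definition cut_ratio (R : realType) (V : finType) (e : rel V) (U : {set V}) : R :=
  #|edge_cut e U|%:R / (#|U| * (#|V| - #|U|))%:R.

(* The infimum is over a finite set, nonempty as soon as #|V| >= 2, so it is
   then a minimum. *)
Definition cut_alpha (R : realType) (V : finType) (e : rel V) : R :=
  inf [set cut_ratio R e U | U in [set U : {set V} | U != finset.set0 /\ U != [set: V]%SET]]%classic.

Fixpoint path_weight (R : realType) (V : finType) (w : {set V} -> R)
    (x : V) (p : seq V) : R :=
  if p is y :: p' then w [set x; y]%SET + path_weight w y p' else 0.

(* The infimum is over the finite set of simple paths from u to v, nonempty in
   a connected graph, so it is then a minimum. *)
Definition path_metric (R : realType) (V : finType) (e : rel V)
    (w : {set V} -> R) (u v : V) : R :=
  inf [set path_weight w u p |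
       p in [set p : seq V | [/\ path e u p, last u p = v & uniq (u :: p)]]]%classic.

(* greedy_run d U s: s lists, in order of selection, the pairs chosen by a run
   of the greedy heuristic whose set of still unmatched vertices is U. Being a
   relation, it allows every way of breaking ties. *)
Inductive greedy_run (R : realType) (V : finType) (d : V -> V -> R) :
    {set V} -> seq (V * V) -> Prop :=
| greedy_stop : greedy_run d finset.set0 [::]
| greedy_step (U : {set V}) (x y : V) (s : seq (V * V)) :
    x \in U -> y \in U -> x != y ->
    (forall x' y', x' \in U -> y' \in U -> x' != y' -> d x y <= d x' y') ->
    greedy_run d (U :\ x :\ y) s ->
    greedy_run d U ((x, y) :: s).

Definition greedy_matching (R : realType) (V : finType) (d : V -> V -> R)
    (s : seq (V * V)) : Prop := greedy_run d [set: V]%SET s.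

Definition matching_cost (R : realType) (V : finType) (d : V -> V -> R)
    (s : seq (V * V)) : R := \sum_(p <- s) d p.1 p.2.

Definition mutually_independent (dO : measure_display) (Omega : measurableType dO)
    (R : realType) (P : probability Omega R) (I : finType) (A : {set I})
    (X : I -> {RV P >-> R}) : Prop :=
  forall (J : {set I}) (B : I -> set R),
    J \subset A -> (forall i, measurable (B i)) ->
    P (\bigcap_(i in [set` J]) (X i @^-1` B i))%classic =
    (\prod_(i in J) P (X i @^-1` B i)%classic)%E.

(* The family is indexed by all subsets of V; only the members indexed by edges
   are constrained, and only these enter path_metric. *)
Definition exp1_edge_weights (dO : measure_display) (Omega : measurableType dO)
    (R : realType) (P : probability Omega R) (V : finType) (e : rel V)
    (W : {set V} -> {RV P >-> R}) : Prop :=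
  mutually_independent (edges e) W /\
  forall (f : {set V}) (B : set R), f \in edges e -> measurable B ->
    distribution P (W f) B = exponential_prob (1 : R) B.

Lemma greedy_matching_exists (R : realType) (V : finType) (d : V -> V -> R) :
  ~~ odd #|V| -> exists s, greedy_matching d s.
Proof.
rewrite -cardsT /greedy_matching; move: [set: V]%SET => U.
have [m] := ubnP #|U|; elim: m U => // m IH U; rewrite ltnS => leUm evenU.
have [->|[x xU]] := set_0Vmem U; first by exists [::]; exact: greedy_stop.
have [y yU yx] : exists2 y, y \in U & x != y.
  have /set0Pn[y] : U :\ x != finset.set0.
    apply: contraNneq evenU => Ux0.
    by rewrite (cardsD1 x) xU Ux0 cards0.
  by rewrite !inE eq_sym => /andP[xy yU]; exists y.
pose ok (p : V * V) := [&& p.1 \in U, p.2 \in U & p.1 != p.2].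
have ok0 : ok (x, y) by rewrite /ok /= xU yU.
case: (@Order.TotalTheory.arg_minP _ _ _ (x, y) ok (fun p => d p.1 p.2) ok0).
move=> [a b] /and3P[/= aU bU ab] amin.
have cardU : #|U| = #|U :\ a :\ b|.+2.
  by rewrite (cardsD1 a) aU (cardsD1 b (U :\ a)) !inE eq_sym ab bU.
have [||s sP] := IH (U :\ a :\ b).
- by move: leUm; rewrite cardU; apply: leq_trans.
- by move: evenU; rewrite cardU /= negbK.
exists ((a, b) :: s); apply: greedy_step => // x' y' x'U y'U x'y'.
by apply: (amin (x', y')); rewrite /ok /= x'U y'U.
Qed.

(* Main.v *)
(* Let mu = alpha n / 8. A ball U around a vertex, grown by the exploration of the
   graph from that vertex, is left at rate |delta(U)| >= alpha |U| (n - |U|) by the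
   memoryless property of the edge weights. Hence phi(U) = 1/|U| (put to 0 once
   2|U| > n) satisfies E phi(B(u, s)) <= exp(- mu s).
   Once the greedy heuristic is about to pick a pair at distance > t, the k
   unmatched vertices are pairwise at distance > t, so their balls of radius t/2
   are disjoint; by AM-GM, k <= n / m + m \sum_u phi(B(u, t/2)) for all m > 0. With
   m = exp(mu t / 4) the expected number of picked pairs at distance > t is at most
   n exp(- mu t / 4), and a Riemann sum over t bounds the expected cost by
   O(n / mu) = O(1 / alpha). *)
From HB Require Import structures.
Require Import Defs.
From mathcomp Require Import all_boot all_order all_algebra.
From mathcomp Require Import all_classical all_reals all_analysis.
From mathcomp Require Import measurable_realfun ring lra zify.

Set Implicit Arguments.
Unset Strict Implicit.
Unset Printing Implicit Defensive.

Import Order.TTheory GRing.Theory Num.Theory.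
Import numFieldNormedType.Exports.
Local Open Scope ring_scope.

(** * Independent exponential weights *)

(** The exploration is never built as a stochastic process. That the ball around [u] equals [U] at
    both times [s] and [t] is rewritten as a condition on weights: edges inside [U] fix the
    distances within [U], and each cut edge is only compared with a threshold. Raising these
    thresholds one cut edge at a time reduces memorylessness to a fact about one weight and a
    variable independent of it. The choice of 1/|U| balances two effects: the exit rate grows like
    |U|, while a new vertex lowers 1/|U| by the fraction 1/(|U| + 1). The cut-off at half keeps n -
    |U| >= n/2, and is affordable because at most one of several disjoint balls exceeds half. So mu
    is alpha n / 2 times 1/4, where one factor 1/2 comes from bounding exp linearly over a short
    time step and the other from |U|/(|U| + 1) >= 1/2. Ties are broken by an arbitrary function of
    the outcome, so the cost is dominated pointwise by a measurable series. *)

Lemma exponential_prob1_tail (R : realType) (a : R) : 0 <= a ->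
  exponential_prob (1 : R) `]a, +oo[%classic = (expR (- a))%:E.
Proof.
move=> a0; rewrite /exponential_prob integral_itv_obnd_cbnd; last first.
  apply/measurable_EFinP/measurable_funTS.
  exact: measurable_exponential_pdf.
have cexpN : continuous (fun z : R^o => expR (- 1 * z)).
  move=> z; apply: continuous_comp; last exact: continuous_expR.
  by apply: continuousM => //; apply: (@continuousN _ R^o); exact: cst_continuous.
rewrite (@ge0_continuous_FTC2y _ _ (fun x => - (expR (- 1 * x))) _ 0)//.
- by rewrite mulN1r sub0e -EFinN opprK.
- by move=> x ax; apply: exponential_pdf_ge0.
- apply: (@continuous_subspaceW R^o _ _ [set` `[0, +oo[%R]%classic).
    by move=> x /=; rewrite !in_itv/= !andbT; exact: le_trans.
  exact: within_continuous_exponential_pdf.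
- rewrite -oppr0; apply: cvgN.
  rewrite (_ : (fun x => _) = (fun z : R => expR (- z))); last first.
    by apply/funext => x; rewrite mulN1r.
  exact: cvgr_expR.
- by apply: cvgN; apply/cvg_at_right_filter; exact: cexpN.
- move=> x; rewrite in_itv/= andbT => ax.
  by rewrite derive1_exponential_pdf// in_itv/= andbT (le_lt_trans a0).
Qed.

Section independence.
Local Open Scope classical_set_scope.
Context d (Omega : measurableType d) (R : realType) (P : probability Omega R).
Context (I : finType) (X : I -> {RV P >-> R}).

(** A pi-system generating the sigma-algebra of the variables with index in [K]. Independence is
    assumed for such events only; stability under intersection extends it to all that they
    generate. *)
Definition cylinders (K : {set I}) : set (set Omega) :=
  [set E | exists J : {set I}, exists2 B : I -> set R,
     (J \subset K) /\ (forall i, measurable (B i)) &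
     E = \bigcap_(i in [set` J]) (X i @^-1` B i)].

Lemma cylinders_measurable K : cylinders K `<=` measurable.
Proof.
move=> _ [J [B [_ mB] ->]]; apply: fin_bigcap_measurable => //.
by move=> i _; rewrite -[_ @^-1` _]setTI; exact: (measurable_funP (X i)).
Qed.

Lemma cylinders_setI K : setI_closed (cylinders K).
Proof.
move=> _ _ [J1 [B1 [J1K mB1] ->]] [J2 [B2 [J2K mB2] ->]].
exists (J1 :|: J2)%SET; exists (fun i => (if i \in J1 then B1 i else setT) `&`
    (if i \in J2 then B2 i else setT)).
  split; first by rewrite finset.subUset J1K.
  by move=> i; apply: measurableI; case: ifP.
apply/seteqP; split=> [w [h1 h2] i /= _|w h].
  split; case: ifPn => // iJ; [exact: h1|exact: h2].
split=> i /= iJ; have /= := h i; rewrite inE iJ ?orbT; move=> /(_ isT) [] //.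
Qed.

Lemma measurable_cylinders (K : {set I}) i : i \in K ->
  measurable_fun [set: g_sigma_algebraType (cylinders K)]
    (X i : g_sigma_algebraType (cylinders K) -> R).
Proof.
move=> iK _ B mB; rewrite setTI; apply: sub_gen_smallest.
exists [set i]%SET; exists (fun=> B); first by rewrite finset.sub1set.
apply/seteqP; split=> [w wB j /=|w h]; first by rewrite inE => /eqP ->.
by have /= := h i; rewrite inE eqxx; apply.
Qed.

Lemma sub_cylinders_measurable K : <<s cylinders K >> `<=` measurable.
Proof.
apply: smallest_sub; first exact: sigma_algebra_measurable.
exact: cylinders_measurable.
Qed.

(** As functions of [E] both sides are finite measures: [P] restricted to the event on [X f], and
    [P] scaled by the probability of that event. They agree on the cylinders avoiding [f], hence on
    the sigma-algebra generated by these. *)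
Lemma indep_cylinders (A : {set I}) (f : I) (E : set Omega) (B : set R) :
  mutually_independent A X -> f \in A -> <<s cylinders (A :\ f)%SET >> E ->
  measurable B -> P (E `&` X f @^-1` B) = (P E * P (X f @^-1` B))%E.
Proof.
move=> indep fA sE mB.
have mY : measurable (X f @^-1` B).
  by rewrite -[_ @^-1` _]setTI; exact: (measurable_funP (X f)).
have PYfin : P (X f @^-1` B) \is a fin_num by apply: fin_num_measure.
have r0 : 0 <= fine (P (X f @^-1` B)) by apply: fine_ge0.
pose m1 := mrestr P mY; pose m2 := mscale (NngNum r0) P.
have m2E S : m2 S = (P S * P (X f @^-1` B))%E.
  by rewrite /m2 /mscale /= fineK// muleC.
rewrite -m2E -[LHS]/(m1 E).
have HE : [set Y | cylinders (A :\ f)%SET Y /\ Y `<=` [set: Omega]] =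
          cylinders (A :\ f)%SET.
  by apply/seteqP; split=> Y => [[]|].
have := @g_sigma_algebra_measure_unique_trace _ R Omega
   (cylinders (A :\ f)%SET) setT measurableT.
rewrite HE => /(_ _ _ m1 m2); apply => //.
- exact: cylinders_measurable.
- exact: cylinders_setI.
- by rewrite [RHS]m2E /m1 /= /mrestr setTI probability_setT mul1e.
- move=> _ [J [C [JA mC] ->]]; rewrite [RHS]m2E.
  pose D i := if i == f then B else C i.
  have mD i : measurable (D i) by rewrite /D; case: eqP.
  have fJ : f \notin J.
    by apply/negP => fJ; have := fintype.subsetP JA _ fJ; rewrite !inE eqxx.
  have JD i : i \in J -> D i = C i.
    by rewrite /D; case: eqP => // ->; rewrite (negbTE fJ).
  have JA' : J \subset A.
    exact: (fintype.subset_trans JA (finset.subsetDl _ _)).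
  have := indep (f |: J)%SET D; rewrite finset.subUset finset.sub1set fA JA'.
  move=> /(_ isT mD); rewrite finset.big_setU1//= [D f]/D eqxx.
  have := indep J D JA' mD.
  have -> : \bigcap_(i in [set` J]) X i @^-1` D i =
            \bigcap_(i in [set` J]) X i @^-1` C i.
    by apply: eq_bigcapr => i /= iJ; rewrite JD.
  move=> <-; rewrite muleC => <-; rewrite /m1 /mrestr; congr (P _).
  apply/seteqP; split=> [w [h1 h2] i /=|w h].
    rewrite !inE => /orP[/eqP ->|iJ]; first by rewrite /D eqxx.
    by rewrite JD//; exact: h1.
  split; last by have /= := h f; rewrite !inE eqxx /D eqxx; apply.
  by move=> i /= iJ; have /= := h i; rewrite !inE iJ orbT JD//; apply.
- by rewrite /m1 /= /mrestr setTI -ge0_fin_numE.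
Qed.

(** [Q] is independent of [X f], so their joint law is a product, and on the section at q >= 0 the
    two tails are exp(-(q + h)) and exp(-q). The sign of [Q] can carry an event: [Q] is given a
    negative value off it. *)
Lemma memoryless (A : {set I}) (f : I) (Q : Omega -> R) (h : R) :
  mutually_independent A X -> f \in A ->
  (forall B, measurable B -> distribution P (X f) B = exponential_prob (1 : R) B) ->
  measurable_fun [set: g_sigma_algebraType (cylinders (A :\ f)%SET)]
    (Q : g_sigma_algebraType (cylinders (A :\ f)%SET) -> R) ->
  0 <= h ->
  P [set w | 0 <= Q w /\ Q w + h < X f w] =
    ((expR (- h))%:E * P [set w | (0 <= Q w)%R /\ (Q w < X f w)%R])%E.
Proof.
move=> indep fA law mQ' h0.
have mQ : measurable_fun setT Q.
  move=> _ B mB; apply: (@sub_cylinders_measurable (A :\ f)%SET).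
  exact: mQ'.
pose Qm := isMeasurableFun.Build _ _ _ _ Q mQ.
pose QX : {mfun Omega >-> R} := HB.pack Q Qm.
have mpair : measurable_fun setT (fun w => (Q w, X f w)).
  by apply: measurable_fun_pair.
pose pairm := isMeasurableFun.Build _ _ _ _ _ mpair.
pose QY : {mfun Omega >-> (R * R)%type} := HB.pack (fun w => (Q w, X f w)) pairm.
have prodE Z : measurable Z -> P ((fun w => (Q w, X f w)) @^-1` Z) =
   (distribution P QX \x distribution P (X f))%E Z.
  move=> mZ; rewrite (product_measure_unique (m' := distribution P QY))//.
  move=> B C mB mC; rewrite -[LHS]/(P (Q @^-1` B `&` X f @^-1` C)).
  by rewrite (indep_cylinders (A := A))// -[Q @^-1` B]setTI; exact: mQ'.
pose Z (a : R) : set (R * R) := [set z | 0 <= z.1 /\ z.1 + a < z.2].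
have mZ a : measurable (Z a).
  have mb : measurable_fun [set: R * R]
      (fun z : R * R => (0 <= z.1) && (z.1 + a < z.2)).
    apply: measurable_and.
      by apply: measurable_fun_ler => //; exact: measurable_fst.
    apply: measurable_fun_ltr; last exact: measurable_snd.
    by apply: measurable_funD => //; exact: measurable_fst.
  rewrite (_ : Z a = setT `&` (fun z : R * R => (0 <= z.1) && (z.1 + a < z.2)) @^-1`
    [set true]); first by apply: mb.
  by rewrite setTI; apply/seteqP; split=> z /=; [move=> [-> ->]|case/andP].
have secE a q : 0 <= a -> distribution P (X f) (xsection (Z a) q) =
    ((expR (- a))%:E * distribution P (X f) (xsection (Z 0%R) q))%E.
  move=> a0; have [q0|q0] := leP 0 q; last first.
    have secZ b : xsection (Z b) q = set0.
      by apply/seteqP; split=> y //; rewrite /xsection /= inE /Z /= leNgt q0 => -[].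
    by rewrite !secZ measure0 mule0.
  have secZ b : 0 <= b -> distribution P (X f) (xsection (Z b) q) =
                          (expR (- (q + b)))%:E.
    move=> b0; rewrite (_ : xsection _ _ = `]q + b, +oo[%classic).
      by rewrite law// exponential_prob1_tail// addr_ge0.
    apply/seteqP; split=> y; rewrite /xsection /= inE /Z /= in_itv/= andbT.
      by case.
    by [].
  by rewrite !secZ// -EFinM -expRD addr0 opprD addrC.
have PE a : P [set w | 0 <= Q w /\ Q w + a < X f w] =
    (\int[distribution P QX]_q distribution P (X f) (xsection (Z a) q))%E.
  exact: (prodE (Z a)).
rewrite PE.
have -> : [set w | 0 <= Q w /\ Q w < X f w] =
          [set w | 0 <= Q w /\ Q w + 0 < X f w].
  by apply/seteqP; split=> w /=; rewrite addr0.
rewrite PE -ge0_integralZl//.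
- by apply: eq_integral => q _; exact: secE.
- exact: measurable_fun_xsection.
Qed.

End independence.

(** * Path metrics *)

Section bigmin_seq.
Context (R : realType) (T : eqType) (F : T -> R).

Lemma bigmin_seq_le p0 s q : q \in p0 :: s ->
  \big[Num.min/F p0]_(p <- s) F p <= F q.
Proof.
elim: s => [|r s IH]; first by rewrite big_nil inE => /eqP ->.
rewrite big_cons ge_min !inE orbCA => /orP[/eqP ->|qs]; first by rewrite lexx.
by rewrite IH ?orbT// inE.
Qed.

Lemma bigmin_seq_attained p0 s : exists2 p, p \in p0 :: s &
  \big[Num.min/F p0]_(p <- s) F p = F p.
Proof.
elim: s => [|q s [p ps IH]]; first by exists p0; rewrite ?big_nil ?mem_head.
rewrite big_cons IH; case: leP => _; first by exists q; rewrite // !inE eqxx orbT.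
by exists p => //; move: ps; rewrite !inE => /orP[->|->]//; rewrite !orbT.
Qed.

End bigmin_seq.

Section path_metric_theory.
Context (R : realType) (V : finType).
Implicit Types (e : rel V) (w : {set V} -> R) (u v x y : V) (p q : seq V).

Lemma path_weight_cat w x p q :
  path_weight w x (p ++ q) = path_weight w x p + path_weight w (last x p) q.
Proof. by elim: p x => [|y p IH] x /=; rewrite ?add0r// IH addrA. Qed.

Lemma edge_mem e x y : e x y -> [set x; y]%SET \in edges e.
Proof. by move=> exy; apply/imsetP; exists (x, y); rewrite ?inE. Qed.

Lemma path_weight_ge0 e w x p : (forall f, f \in edges e -> 0 <= w f) ->
  path e x p -> 0 <= path_weight w x p.
Proof.
move=> w0; elim: p x => //= y p IH x /andP[exy pp].
by rewrite addr_ge0 ?IH// w0// edge_mem.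
Qed.

Lemma eq_path_weight e w w' x p : {in edges e, w =1 w'} ->
  path e x p -> path_weight w x p = path_weight w' x p.
Proof.
move=> ww'; elim: p x => //= y p IH x /andP[exy pp].
by rewrite IH// ww'// edge_mem.
Qed.

(** The infimum in [path_metric] runs over simple paths, whereas estimates glue walks together.
    Cutting out loops bridges the two, and does not raise a nonnegative weight. *)
Lemma walk_to_simple_path e w x p : (forall f, f \in edges e -> 0 <= w f) ->
  path e x p -> exists q, [/\ path e x q, last x q = last x p, uniq (x :: q) &
    path_weight w x q <= path_weight w x p].
Proof.
move=> w0; elim: p x => [|y p IH] x /=; first by exists [::].
move=> /andP[exy /IH[q [pq lq uq leq]]].
have [xq|xq] := boolP (x \in y :: q); last first.
  by exists (y :: q); split => //=; [rewrite exy|rewrite xq|rewrite lerD2l].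
have [xy|xy] := eqVneq x y; first by
  exists q; split; rewrite xy// (le_trans leq)// lerDr w0// -{1}xy edge_mem.
move: xq; rewrite inE (negbTE xy) /= => xq.
move: pq lq uq leq; case/splitPr: xq => q1 q2.
rewrite cat_path last_cat /= => /and3P[pq1 eq1 pq2] lq uq leq {xy}.
exists q2; split => //.
  by move: uq => /= /andP[_]; rewrite cat_uniq => /and3P[].
move: leq; rewrite path_weight_cat/= => leq.
apply: le_trans (le_trans leq _); last by rewrite lerDr w0// edge_mem.
by rewrite addrA lerDr addr_ge0 ?(path_weight_ge0 w0 pq1) ?w0 ?edge_mem.
Qed.

(** A finite enumeration that turns the infimum into an iterated minimum, the source of both
    attainment and measurability. The length bound loses nothing, as a simple path never repeats a
    vertex. *)
Definition simple_paths e u v : seq (seq V) :=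
  [seq p : seq V <- [seq val t | t <- enum {: #|V|.-bseq V}] |
    [&& path e u p, last u p == v & uniq (u :: p)]].

Lemma mem_simple_paths e u v p :
  (p \in simple_paths e u v) = [&& path e u p, last u p == v & uniq (u :: p)].
Proof.
rewrite mem_filter andb_idr// => /and3P[_ _ up].
have sp : (size p <= #|V|)%N.
  by have := max_card [in u :: p]; rewrite (card_uniqP up); apply: leq_trans => /=.
by apply/mapP; exists (Bseq sp); rewrite ?mem_enum.
Qed.

Lemma path_metric_bigmin e w u v : path_metric e w u v =
  if simple_paths e u v is p0 :: s then
    \big[Num.min/path_weight w u p0]_(p <- s) path_weight w u p else 0.
Proof.
rewrite /path_metric; set A := (X in inf X).
have AE : A = [set path_weight w u p | p in [set p | p \in simple_paths e u v]]%classic.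
  rewrite /A; congr (_ @` _)%classic; apply/seteqP; split=> p /=.
    by move=> [? ? ?]; rewrite mem_simple_paths; apply/and3P; split => //; apply/eqP.
  by rewrite mem_simple_paths => /and3P[? /eqP ? ?].
case E : (simple_paths e u v) AE => [|p0 s] ->.
  by rewrite (_ : image _ _ = set0) ?inf0// -subset0 => t [p].
apply/eqP; rewrite eq_le; apply/andP; split.
  have [p ps ->] := bigmin_seq_attained (path_weight w u) p0 s.
  apply: ge_inf; last by exists p.
  exists (\big[Num.min/path_weight w u p0]_(p <- s) path_weight w u p).
  by move=> _ [q /= qs <-]; exact: bigmin_seq_le.
apply: lb_le_inf; first by exists (path_weight w u p0), p0; rewrite //= mem_head.
by move=> _ [q /= qs <-]; exact: bigmin_seq_le.
Qed.

Lemma eq_path_metric e w w' : {in edges e, w =1 w'} ->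
  path_metric e w =2 path_metric e w'.
Proof.
move=> ww' u v; rewrite /path_metric; congr inf.
by apply/seteqP; split=> _ [p [pp lp up] <-]; exists p => //;
  rewrite (eq_path_weight ww' pp).
Qed.

Lemma path_metric_attained e w u v : connect e u v ->
  exists2 p, path e u p /\ last u p = v & path_metric e w u v = path_weight w u p.
Proof.
move=> /connectP[p0 pp0 lp0].
(* Loops are removed with respect to the zero weight, as nothing is assumed here about the sign of
   [w]. *)
have [q [pq lq uq _]] := walk_to_simple_path (w := fun=> 0) (fun _ _ => lexx _) pp0.
have : q \in simple_paths e u v by rewrite mem_simple_paths pq lq -lp0 eqxx.
rewrite path_metric_bigmin; have := mem_simple_paths e u v.
case: (simple_paths e u v) => // r s memE _.
have [p ps ->] := bigmin_seq_attained (path_weight w u) r s.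
by move: ps; rewrite memE => /and3P[pp /eqP lp _]; exists p.
Qed.

Lemma path_metric_le_walk e w u p : (forall f, f \in edges e -> 0 <= w f) ->
  path e u p -> path_metric e w u (last u p) <= path_weight w u p.
Proof.
move=> w0 pp; have [q [pq lq uq]] := walk_to_simple_path w0 pp.
apply: le_trans; apply: ge_inf; last by exists q.
by exists 0 => _ [r [pr _ _] <-]; exact: path_weight_ge0 pr.
Qed.

Lemma path_weight_rev e w x p : symmetric e -> path e x p ->
  exists q, [/\ path e (last x p) q, last (last x p) q = x &
    path_weight w (last x p) q = path_weight w x p].
Proof.
move=> syme; elim: p x => [|y p IH] x /=; first by exists [::].
move=> /andP[exy /IH[q [pq lq wq]]]; exists (rcons q x).
rewrite rcons_path pq lq syme exy last_rcons; split => //.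
by rewrite -cats1 path_weight_cat lq wq/= addr0 addrC finset.setUC.
Qed.

Lemma path_metric_triangle e w u v x : symmetric e ->
  (forall f, f \in edges e -> 0 <= w f) -> connect e u x -> connect e v x ->
  path_metric e w u v <= path_metric e w u x + path_metric e w v x.
Proof.
move=> syme w0 /(path_metric_attained w)[p [pp lp] ->].
move=> /(path_metric_attained w)[q [pq lq] ->].
have [r []] := path_weight_rev w syme pq.
rewrite lq -lp => pr lr wr.
have := path_metric_le_walk w0 (p := p ++ r) (u := u).
by rewrite cat_path pp pr last_cat lr path_weight_cat -wr lp; apply.
Qed.

End path_metric_theory.

(** * Separated sets and the greedy heuristic *)

Definition ball_of (R : realType) (V : finType) (e : rel V) (w : {set V} -> R)
  (u : V) (s : R) : {set V} := [set x | path_metric e w u x <= s].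

Definition inv_small (R : realType) (n k : nat) : R :=
  if (k.*2 <= n)%N then k%:R^-1 else 0.

Section balls.
Context (R : realType) (V : finType) (e : rel V) (w : {set V} -> R).
Hypothesis w0 : forall f, f \in edges e -> 0 <= w f.

Lemma path_metric_refl u : path_metric e w u u <= 0.
Proof. exact: (path_metric_le_walk w0 (p := [::])). Qed.

Lemma mem_ball_center u s : 0 <= s -> u \in ball_of e w u s.
Proof. by rewrite inE; apply: le_trans (path_metric_refl u). Qed.

Hypotheses (syme : symmetric e) (conn : forall x y, connect e x y).

Lemma disjoint_balls u v s : s + s < path_metric e w u v ->
  [disjoint ball_of e w u s & ball_of e w v s].
Proof.
move=> suv; apply/pred0P => x /=; apply/negbTE/negP; rewrite !inE => /andP[ux vx].
have := path_metric_triangle syme w0 (conn u x) (conn v x).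
by move=> /(lt_le_trans suv); rewrite ltNge lerD.
Qed.

(* At most one ball of a separated family holds more than half of the vertices,
   so at least half of them are small; for these,
   [2 <= #|B| / m + m / #|B|] and the balls are disjoint. *)
Lemma separated_card_le (S : {set V}) s m : 0 <= s -> 0 < m ->
  (forall x y, x \in S -> y \in S -> x != y -> s + s < path_metric e w x y) ->
  (1 < #|S|)%N ->
  #|S|%:R <= #|V|%:R / m +
    m * \sum_u inv_small R #|V| #|ball_of e w u s|.
Proof.
move=> s0 m0 sepS S1; set B := fun u => ball_of e w u s.
pose S' := [set u in S | (#|B u|.*2 <= #|V|)%N].
have disj u v : u \in S -> v \in S -> u != v -> [disjoint B u & B v].
  by move=> uS vS uv; apply: disjoint_balls; exact: sepS.
have big1 : (#|S :\: S'| <= 1)%N.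
  apply/card_le1_eqP => u v; rewrite !inE.
  move=> /andP[+ uS] /andP[+ vS]; rewrite uS vS/= -!ltnNge => Bu Bv.
  apply/eqP/negPn/negP; rewrite eq_sym => uv; have := disj u v uS vS uv.
  rewrite -(leq_card_setU _ _).2 => /eqP E.
  have half a b c : (c < a.*2 -> c < b.*2 -> c < a + b)%N by lia.
  by have := half _ _ _ Bu Bv; rewrite -E ltnNge max_card.
have S'S : S' \subset S by apply/fintype.subsetP => u; rewrite inE => /andP[].
(* Dropping at most one vertex from at least two leaves at least half of them. *)
have cS : (#|S| <= #|S'|.*2)%N.
  have := cardsID S' S; rewrite (finset.setIidPr S'S).
  by move: big1 S1; lia.
(* Double counting: by disjointness each vertex lies in at most one of the balls. *)
have sumB : (\sum_(u in S') #|B u| <= #|V|)%N.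
  rewrite -(eq_bigr _ (fun u _ => sum1_card (mem (B u)))) /=.
  under eq_bigr do rewrite big_mkcond /=.
  rewrite exchange_big /= -[leqRHS]sum1_card; apply: leq_sum => x _.
  rewrite -big_mkcondr /= sum1_card; apply/card_le1_eqP => u v.
  rewrite !unfold_in /= => /andP[uS' xu] /andP[vS' xv].
  apply/eqP/negPn/negP; rewrite eq_sym => uv.
  have := disj _ _ (fintype.subsetP S'S _ uS') (fintype.subsetP S'S _ vS') uv.
  move=> /pred0P /(_ x) /=.
  by rewrite (xu : x \in B u) (xv : x \in B v).
have small u : u \in S' -> 2 <= #|B u|%:R / m + m * inv_small R #|V| #|B u|.
  rewrite inE => /andP[_ Bu]; rewrite /inv_small Bu.
  have b0 : 0 < #|B u|%:R :> R.
    by rewrite ltr0n; apply/card_gt0P; exists u; exact: mem_ball_center.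
  set b := #|B u|%:R in b0 *.
  have -> : b / m + m * b^-1 = 2 + (b - m) ^+ 2 / (m * b).
    by field; rewrite !gt_eqF.
  by rewrite lerDl divr_ge0 ?sqr_ge0// mulr_ge0// ltW.
apply: (@le_trans _ _ (\sum_(u in S') 2)).
  by rewrite sumr_const -mulrnA ler_nat mul2n.
apply: le_trans (ler_sum _ small) _; rewrite big_split/= -mulr_suml -mulr_sumr.
apply: lerD.
  by rewrite ler_pM2r ?invr_gt0// -natr_sum ler_nat.
rewrite ler_pM2l// [leRHS](bigID (mem S'))/= lerDl sumr_ge0// => u _.
by rewrite /inv_small; case: ifP.
Qed.

End balls.

(** [S] is the set of vertices unmatched when a pair at distance above [t] is first picked (empty if
    this never happens). The minimality of that pair separates [S], and every counted pair uses two
    vertices of [S]. *)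
Lemma greedy_run_separated (R : realType) (V : finType) (d : V -> V -> R)
  (U : {set V}) (M : seq (V * V)) (t : R) : greedy_run d U M ->
  exists S : {set V}, [/\ S \subset U,
    forall x y, x \in S -> y \in S -> x != y -> t < d x y &
    ((count (fun p => t < d p.1 p.2)%R M).*2 <= #|S|)%N].
Proof.
have sizeM U' M' : greedy_run d U' M' -> #|U'| = (size M').*2.
  elim=> [|U0 x y s xU yU xy _ _ IH]; first by rewrite cards0.
  rewrite [size _]/= doubleS -IH.
  by rewrite (cardsD1 x) xU (cardsD1 y (U0 :\ x)) !inE eq_sym xy yU.
elim=> [|U0 x y s xU yU xy dmin run [S [SU sepS cS]]].
  by exists finset.set0; rewrite cards0; split => // x y; rewrite inE.
have [dt|dt] := boolP (t < d x y); last first.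
  exists S; rewrite /= (negbTE dt); split => //.
  apply: fintype.subset_trans SU _.
  by rewrite (fintype.subset_trans (finset.subsetDl _ _))// finset.subsetDl.
exists U0; split => // [x' y' xU' yU' xy'|].
  by apply: lt_le_trans (dmin _ _ xU' yU' xy').
have := sizeM _ _ (greedy_step xU yU xy dmin run) => ->.
by rewrite leq_double count_size.
Qed.

(** A distance is at most [tau] times the number of multiples [i%:R * tau] strictly below it. [N]
    only has to exceed the largest distance in units of [tau]. *)
Lemma matching_cost_le (R : realType) (V : finType) (d : V -> V -> R)
  (M : seq (V * V)) (tau : R) : 0 < tau ->
  exists N, matching_cost d M <=
    \sum_(0 <= i < N) tau * (count (fun p => i%:R * tau < d p.1 p.2) M)%:R.
Proof.
move=> tau0; rewrite /matching_cost.
have le1 (x : R) N : x <= N%:R * tau ->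
    x <= \sum_(0 <= i < N) tau * (i%:R * tau < x)%R%:R.
  elim: N => [|N IH]; first by rewrite big_nil mul0r.
  rewrite big_nat_recr//=; have [xN _|xN] := leP x (N%:R * tau).
    by rewrite mulr0 addr0 IH.
  rewrite mulr1 -natr1 mulrDl mul1r => /le_trans; apply; rewrite lerD2r.
  rewrite -mulr_sumr mulrC ler_pM2l// big_seq.
  rewrite (eq_bigr (fun=> 1)) -?big_seq; last first.
    move=> i; rewrite mem_index_iota => /andP[_ iN].
    by rewrite (le_lt_trans _ xN)// ler_pM2r// ler_nat ltnW.
  by rewrite big_const_nat iter_addr addr0 subn0.
have [N leN] : exists N, forall p, p \in M -> d p.1 p.2 <= N%:R * tau.
  elim: M => [|p M [N IH]]; first by exists 0%N.
  exists (maxn N (Num.bound `|d p.1 p.2 / tau|)) => q.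
  rewrite inE => /orP[/eqP ->|/IH leq].
    rewrite -ler_pdivrMr// (le_trans (ler_norm _))//.
    rewrite (le_trans (ltW (archi_boundP (normr_ge0 _))))//.
    by rewrite ler_nat leq_maxr.
  by rewrite (le_trans leq)// ler_pM2r// ler_nat leq_maxl.
exists N; under [leRHS]eq_bigr => i _.
  rewrite -sum1_count natr_sum big_mkcond mulr_sumr.
  over.
rewrite exchange_big /= big_seq [leRHS]big_seq.
apply: ler_sum => p pM; apply: le_trans (le1 _ _ (leN _ pM)) _.
by apply: ler_sum => i _; case: ifP.
Qed.

(** * Exploration of the balls *)

Definition induced_rel (V : finType) (e : rel V) (U : {set V}) : rel V :=
  [rel x y | [&& e x y, x \in U & y \in U]].

(* The endpoint in U of a cut edge f; u is a junk value. *)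
Definition anchor (V : finType) (u : V) (U f : {set V}) : V :=
  odflt u [pick x in f :&: U].

(** The event that the ball is [U], reduced to the weights it involves: induced distances inside
    [U], and one comparison per cut edge. Thresholds depend on the edge so that they can be raised
    one at a time; [C] is an argument so that one edge can be left out. *)
Definition settled (R : realType) (V : finType) (e : rel V) (w : {set V} -> R)
    (u : V) (U : {set V}) (C : {set {set V}}) (s : R) (t : {set V} -> R) : Prop :=
  (forall x, x \in U -> path_metric (induced_rel e U) w u x <= s) /\
  (forall f, f \in C ->
    t f < path_metric (induced_rel e U) w u (anchor u U f) + w f).

(** A nonrandom condition satisfied by every ball. It excludes sets on which [path_metric] of the
    induced graph takes the default value 0, where [settled] would hold for the wrong reason. *)
Definition reachable (V : finType) (e : rel V) (u : V) (U : {set V}) : Prop :=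
  u \in U /\ forall x, x \in U -> connect (induced_rel e U) u x.

Section settled_theory.
Context (R : realType) (V : finType) (e : rel V).
Implicit Types (w : {set V} -> R) (U f : {set V}).

Lemma edges_induced U : edges (induced_rel e U) \subset edges e.
Proof.
apply/fintype.subsetP => f /imsetP[[x y]]; rewrite inE => /and3P[exy _ _] ->.
exact: edge_mem.
Qed.

Lemma edge_cut_mem U x y : e x y -> x \in U -> y \notin U ->
  [set x; y]%SET \in edge_cut e U.
Proof.
move=> exy xU yU; rewrite inE edge_mem//=.
rewrite finset.setIUl (finset.setIidPl _) ?finset.sub1set//.
suff -> : [set y]%SET :&: U = finset.set0 by rewrite finset.setU0 cards1.
by apply/eqP; rewrite finset.setI_eq0 disjoints1.
Qed.

Lemma anchorE u U x y : x \in U -> y \notin U -> anchor u U [set x; y]%SET = x.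
Proof.
move=> xU yU; rewrite /anchor; case: pickP => [z|/(_ x)] /=.
  by rewrite !inE => /andP[/orP[/eqP ->//|/eqP ->]]; rewrite (negbTE yU).
by rewrite !inE eqxx xU.
Qed.

Hypotheses (syme : symmetric e) (irre : irreflexive e).

Lemma edge_cutP u U f : f \in edge_cut e U -> exists x y,
  [/\ e x y, x \in U, y \notin U & f = [set x; y]%SET /\ anchor u U f = x].
Proof.
rewrite inE => /andP[/imsetP[[x y]]]; rewrite inE /= => exy -> cU.
have [xU|xU] := boolP (x \in U); have [yU|yU] := boolP (y \in U).
- move: cU; rewrite (finset.setIidPl _); last first.
    by rewrite finset.subUset !finset.sub1set xU.
  by have [xy|xy] := eqVneq x y; [rewrite xy irre in exy|rewrite cards2 xy].
- by exists x, y; split => //; rewrite anchorE.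
- exists y, x; rewrite syme; split => //.
  by rewrite finset.setUC anchorE.
- move: cU; rewrite (_ : _ :&: U = finset.set0) ?cards0//.
  apply/setP => z; rewrite !inE.
  case: eqVneq => [->|_]; first by rewrite (negbTE xU) andbF.
  by case: eqVneq => [->|_] //; rewrite (negbTE yU).
Qed.

Hypothesis conn : forall x y, connect e x y.
Variable w : {set V} -> R.
Hypothesis w0 : forall f, f \in edges e -> 0 <= w f.

Lemma induced_weight_ge0 U f : f \in edges (induced_rel e U) -> 0 <= w f.
Proof. by move=> /(fintype.subsetP (edges_induced U)); exact: w0. Qed.

Lemma induced_path U x p : path (induced_rel e U) x p -> path e x p.
Proof. by apply: sub_path => y z /and3P[]. Qed.

(** Prefixes of the path weigh no more than the whole, so all its vertices lie in the ball. *)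
Lemma path_in_ball u s p : 0 <= s -> path e u p -> path_weight w u p <= s ->
  path (induced_rel e (ball_of e w u s)) u p.
Proof.
move=> s0; elim/last_ind: p => [//|p y IH]; rewrite !rcons_path => /andP[pp ey].
rewrite -cats1 path_weight_cat/= addr0 => le_s.
have wy : 0 <= w [set last u p; y]%SET by rewrite w0// edge_mem.
have le_p : path_weight w u p <= s by apply: le_trans le_s; rewrite lerDl.
rewrite IH// /induced_rel/= ey !inE (le_trans (path_metric_le_walk w0 pp))//=.
have := path_metric_le_walk w0 (u := u) (p := rcons p y).
rewrite rcons_path pp ey last_rcons => /(_ isT) /le_trans; apply.
by rewrite -cats1 path_weight_cat/= addr0.
Qed.

Lemma ball_reachable u s : 0 <= s -> reachable e u (ball_of e w u s).
Proof.
move=> s0; split; first exact: mem_ball_center.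
move=> x; rewrite inE => xs.
have [p [pp lp] wp] := path_metric_attained w (conn u x).
by apply/connectP; exists p; rewrite ?lp// path_in_ball// -wp.
Qed.

(** From left to right: a walk leaving [U] does so through a cut edge and then already weighs more
    than [t]. Conversely, paths of weight at most [s] stay in the ball, so induced distances are
    true ones, and a cut edge violating its bound would bring its outer end into the ball of radius
    [t]. *)
Lemma settled_balls u U s t : 0 <= s -> s <= t -> reachable e u U ->
  settled e w u U (edge_cut e U) s (fun=> t) <-> ball_of e w u s = U /\ ball_of e w u t = U.
Proof.
move=> s0 st [uU reachU]; split=> [[inU cutU]|[sU tU]].
  have out p : path e u p -> path (induced_rel e U) u p \/ t < path_weight w u p.
    elim/last_ind: p => [|p y IH]; first by left.
    rewrite !rcons_path -cats1 path_weight_cat/= addr0 => /andP[pp ey].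
    have wy : 0 <= w [set last u p; y]%SET by rewrite w0// edge_mem.
    have [Up|lt_t] := IH pp; last by right; rewrite (lt_le_trans lt_t)// lerDl.
    have lU : last u p \in U.
      case: (lastP p) Up => // q z; rewrite rcons_path last_rcons.
      by move=> /andP[_ /and3P[]].
    have [yU|yU] := boolP (y \in U); first by left; rewrite Up /induced_rel/= ey lU yU.
    right; apply: lt_le_trans (cutU _ (edge_cut_mem ey lU yU)) _.
    rewrite anchorE// lerD2r.
    by apply: path_metric_le_walk Up; exact: induced_weight_ge0.
  have Us : U \subset ball_of e w u s.
    apply/fintype.subsetP => x xU; rewrite inE.
    have [p [pp lp] wp] := path_metric_attained w (reachU x xU).
    apply: le_trans (inU x xU); rewrite wp -lp.
    exact: path_metric_le_walk w0 (induced_path pp).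
  have st' : ball_of e w u s \subset ball_of e w u t.
    by apply/fintype.subsetP => x; rewrite !inE => /le_trans; apply.
  have tU : ball_of e w u t \subset U.
    apply/fintype.subsetP => y; rewrite inE.
    have [p [pp lp] ->] := path_metric_attained w (conn u y).
    have [Up|] := out p pp; last by rewrite ltNge => /negbTE ->.
    case: (lastP p) Up lp => [_ <-//|q z]; rewrite rcons_path last_rcons.
    by move=> /andP[_ /and3P[_ _ zU]] <-.
  split; apply/eqP; rewrite finset.eqEsubset ?Us ?tU ?andbT/=.
    exact: fintype.subset_trans tU.
  exact: fintype.subset_trans st'.
have wU := @induced_weight_ge0 U.
split=> [x xU|f /(edge_cutP u)[x [y [exy xU yU [-> ->]]]]].
  have xs : x \in ball_of e w u s by rewrite sU.
  move: xs; rewrite inE => xs.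
  have [p [pp lp] wp] := path_metric_attained w (conn u x).
  rewrite wp in xs; apply: le_trans (xs); rewrite -lp; apply: path_metric_le_walk => //.
  by rewrite -sU path_in_ball.
rewrite ltNge; apply: contra yU => le_t; rewrite -tU inE.
have [p [pp lp] wp] := path_metric_attained w (reachU x xU).
have := path_metric_le_walk w0 (u := u) (p := rcons p y).
rewrite rcons_path (induced_path pp) lp exy last_rcons => /(_ isT) /le_trans; apply.
by rewrite -cats1 path_weight_cat/= addr0 lp -wp.
Qed.

End settled_theory.

(** The measurable space is arbitrary because the sigma-algebra generated by all edge weights but
    one is used as well as that of [Omega]. *)
Lemma measurable_path_metric d (T : measurableType d) (R : realType)
    (V : finType) (e : rel V) (W : {set V} -> T -> R) u v :
  (forall f, f \in edges e -> measurable_fun setT (W f)) ->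
  measurable_fun setT (fun z => path_metric e (W ^~ z) u v).
Proof.
move=> mW.
have mp p : path e u p -> measurable_fun setT (fun z => path_weight (W ^~ z) u p).
  elim: p u => [|y p IH] x //= /andP[exy pp].
  by apply: measurable_funD; [apply: mW; exact: edge_mem|exact: IH].
under [X in measurable_fun _ X]eq_fun do rewrite path_metric_bigmin.
have := mem_simple_paths e u v.
case: (simple_paths e u v) => [|p0 s] mems; first exact: measurable_cst.
have pth p : p \in p0 :: s -> path e u p by rewrite mems => /and3P[].
elim: s {mems} pth => [|q s IH] pth.
  under eq_fun do rewrite big_nil.
  by apply/mp/pth/mem_head.
under eq_fun do rewrite big_cons.
apply: measurable_minr; first by apply/mp/pth; rewrite !inE eqxx orbT.
by apply: IH => p; rewrite inE => ps; apply: pth; rewrite !inE orbCA ps orbT.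
Qed.

Lemma measurable_settled d (T : measurableType d) (R : realType)
    (V : finType) (e : rel V) (W : {set V} -> T -> R) u U C s t :
  (forall f, f \in edges (induced_rel e U) :|: C -> measurable_fun setT (W f)) ->
  measurable [set z | settled e (W ^~ z) u U C s t]%classic.
Proof.
move=> mW.
have mD x : measurable_fun setT (fun z => path_metric (induced_rel e U) (W ^~ z) u x).
  by apply: measurable_path_metric => f fU; apply: mW; rewrite inE fU.
have mpre (b : T -> bool) : measurable_fun setT b -> measurable [set z | b z]%classic.
  move=> mb; rewrite (_ : mkset _ = setT `&` b @^-1` [set true])%classic.
    exact: mb.
  by rewrite setTI.
rewrite (_ : mkset _ =
  (\bigcap_(x in [set` U]) [set z | path_metric (induced_rel e U) (W ^~ z) u x <= s])
  `&` (\bigcap_(f in [set` C])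
    [set z | (t f < path_metric (induced_rel e U) (W ^~ z) u (anchor u U f) + W f z)%R]))%classic.
  apply: measurableI; (apply: fin_bigcap_measurable; first by []) => /= f fC;
    apply: mpre; first exact: measurable_fun_ler.
  apply: measurable_fun_ltr => //; apply: measurable_funD => //.
  by apply: mW; rewrite inE fC orbT.
by apply/seteqP; split=> z [h1 h2]; split.
Qed.

Section exploration.
Local Open Scope classical_set_scope.
Context (R : realType) (V : finType) (e : rel V).
Hypotheses (syme : symmetric e) (irre : irreflexive e).
Context d (Omega : measurableType d) (P : probability Omega R).
Context (W : {set V} -> {RV P >-> R}).
Hypothesis expW : exp1_edge_weights e W.

(* Negative weights form a null event; truncating them makes the metric
   arguments hold everywhere. *)
Definition pos_weight (w : Omega) (f : {set V}) : R := Num.max 0 (W f w).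

Lemma pos_weight_ge0 w f : 0 <= pos_weight w f.
Proof. by rewrite le_max lexx. Qed.

Lemma edge_cut_sub U : edge_cut e U \subset edges e.
Proof. by apply/fintype.subsetP => f; rewrite inE => /andP[]. Qed.

(** Given the other constraints, the one at [f] says that its weight exceeds a quantity determined
    by the other weights, so [memoryless] applies. *)
Lemma settled_raise_one u (U : {set V}) f s t h :
  f \in edge_cut e U -> s <= t f -> 0 <= h ->
  P [set w | settled e (pos_weight w) u U (edge_cut e U) s
       (fun g => if g == f then t f + h else t g)] =
  ((expR (- h))%:E *
   P [set w | settled e (pos_weight w) u U (edge_cut e U) s t])%E.
Proof.
move=> fcut st h0; have [indep law] := expW.
have fE : f \in edges e by exact: (fintype.subsetP (edge_cut_sub U)).
have [x [y [exy xU yU [fxy ax]]]] := edge_cutP syme irre u fcut.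
pose T := g_sigma_algebraType (cylinders W (edges e :\ f)).
have mWT g : g \in (edges e :\ f)%SET ->
    measurable_fun [set: T] (pos_weight ^~ g : T -> R).
  by move=> gE; apply: measurable_maxr => //; exact: measurable_cylinders.
(* Since [f] leaves [U], it is no edge of the induced graph: neither the distances inside [U] nor
   the other constraints depend on its weight. *)
have sub g : g \in edges (induced_rel e U) :|: (edge_cut e U :\ f)%SET ->
    g \in (edges e :\ f)%SET.
  rewrite !inE => /orP[/imsetP[[a b]]|/andP[-> /andP[]//]].
  rewrite inE /induced_rel/= => /and3P[eab aU bU] ->; rewrite edge_mem// andbT.
  apply: contraNneq yU => abf.
  have : y \in f by rewrite fxy !inE eqxx orbT.
  by rewrite -abf !inE => /orP[]/eqP ->.
pose D w z := path_metric (induced_rel e U) (pos_weight w) u z.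
pose A := [set w : T | settled e (pos_weight w) u U (edge_cut e U :\ f)%SET s t].
have mA : measurable A by apply: measurable_settled => g /sub; exact: mWT.
(* The value -1 records that another constraint fails. On [A] the value is nonnegative, as
   [D w x <= s <= t f]. *)
pose Q (w : Omega) : R := if (w : T) \in A then t f - D w x else -1.
have mQ : measurable_fun [set: T] (Q : T -> R).
  apply: measurable_fun_ifT => //.
    apply: (measurable_fun_bool true); rewrite setTI.
    rewrite (_ : _ @^-1` _ = A)//.
    by apply/seteqP; split=> w /=; [move=> /set_mem|move=> /mem_set].
  apply: measurable_funB => //; apply: measurable_path_metric => g gU.
  by apply: mWT; apply: sub; rewrite finset.in_setU gU.
(* Used with k = h and k = 0. Since [Q w + k] is nonnegative, the truncated weight exceeds it
   exactly when [W f w] does. *)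
have QE k (t' : {set V} -> R) : 0 <= k -> t' f = t f + k ->
    (forall g, g != f -> t' g = t g) ->
    [set w | settled e (pos_weight w) u U (edge_cut e U) s t'] =
    [set w | 0 <= Q w /\ Q w + k < W f w].
  move=> k0 t'f t'g; apply/seteqP; split=> w /=.
    move=> [inU cutU].
    have wA : (w : T) \in A.
      apply/mem_set; split=> // g; rewrite !inE => /andP[gf gcut].
      by rewrite -t'g//; apply: cutU; rewrite inE.
    rewrite /Q wA; have := cutU _ fcut; rewrite ax t'f -/(D w x) => lt1.
    have := inU _ xU; rewrite -/(D w x) => Ds.
    have Q0 : 0 <= t f - D w x by rewrite subr_ge0 (le_trans Ds).
    split => //.
    have : t f - D w x + k < pos_weight w f by move: lt1; lra.
    by rewrite /pos_weight lt_max => /orP[|//]; rewrite ltNge addr_ge0.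
  rewrite /Q; case: ifPn => [/set_mem[inU cutU] [Q0 lt1]|_ []]; last first.
    by rewrite oppr_ge0 ler10.
  split => // g gcut; have [->|gf] := eqVneq g f; last first.
    by rewrite t'g//; apply: cutU; rewrite !inE gf; rewrite inE in gcut.
  rewrite ax t'f -/(D w x).
  have : t f - D w x + k < pos_weight w f by rewrite lt_max lt1 orbT.
  lra.
rewrite (QE h)//; [|by rewrite eqxx|by move=> g /negbTE ->].
rewrite (QE 0)//; last by rewrite addr0.
under [X in _ = (_ * P X)%E]eq_set do rewrite addr0.
apply: (memoryless (A := edges e)) => //.
by move=> B; exact: law.
Qed.

(** Each cut edge contributes a factor exp(-h) when its threshold rises from [s] to [s + h]; in the
    proof [K] lists the edges already raised. *)
Lemma settled_prob u (U : {set V}) s h : 0 <= h ->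
  P [set w | settled e (pos_weight w) u U (edge_cut e U) s (fun=> s + h)] =
  ((expR (- (#|edge_cut e U|%:R * h)))%:E *
   P [set w | settled e (pos_weight w) u U (edge_cut e U) s (fun=> s)])%E.
Proof.
move=> h0.
have main (K : seq {set V}) : uniq K -> {subset K <= edge_cut e U} ->
  P [set w | settled e (pos_weight w) u U (edge_cut e U) s
               (fun g => if g \in K then s + h else s)] =
  ((expR (- ((size K)%:R * h)))%:E *
   P [set w | settled e (pos_weight w) u U (edge_cut e U) s (fun=> s)])%E.
  elim: K => [|f K IH]; first by rewrite mul0r oppr0 expR0 mul1e.
  move=> /= /andP[fK uK] Kcut.
  rewrite -natr1 mulrDl mul1r opprD expRD EFinM [(_ * (expR (- h))%:E)%E]muleC.
  rewrite -muleA -IH//; last by move=> g gK; apply: Kcut; rewrite inE gK orbT.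
  rewrite -(@settled_raise_one u U f)//; last 2 first.
  - by apply: Kcut; rewrite mem_head.
  - by rewrite (negbTE fK).
  congr (P _); apply: eq_set => w; congr settled; apply/funext => g.
  by rewrite inE; case: eqVneq => //= _; rewrite (negbTE fK).
have := main (enum (edge_cut e U)) (enum_uniq _).
rewrite -cardE => <- => [|g]; last by rewrite mem_enum.
congr (P _); apply/seteqP; split=> w [h1 h2]; split => // g gcut.
  by rewrite mem_enum gcut; exact: h2.
by have := h2 g gcut; rewrite mem_enum gcut.
Qed.

End exploration.

(** * Decay of the inverse ball size *)

Lemma inv_small_ge0 (R : realType) n k : 0 <= inv_small R n k.
Proof. by rewrite /inv_small; case: ifP. Qed.

Lemma inv_small0 (R : realType) n k : (n < k.*2)%N -> inv_small R n k = 0.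
Proof. by rewrite /inv_small ltnNge => /negbTE ->. Qed.

Lemma inv_small_le1 (R : realType) n k : inv_small R n k <= 1.
Proof.
rewrite /inv_small; case: ifP => // _; case: k => [|k]; first by rewrite invr0.
by rewrite invf_le1 ?ler1n ?ltr0n.
Qed.

Lemma inv_small_anti (R : realType) n k l : (0 < k <= l)%N ->
  inv_small R n l <= inv_small R n k.
Proof.
move=> /andP[k0 kl]; rewrite /inv_small; case: ifPn => ln; last by case: ifP.
have l0 := leq_trans k0 kl.
by rewrite ifT ?lef_pV2 ?posrE ?ltr0n ?ler_nat// (leq_trans _ ln)// leq_double.
Qed.

(** From 1 + y <= exp(y), as (1 - y/2)(1 + y) = 1 + y(1 - y)/2 >= 1. *)
Lemma expRN_le_half (R : realType) (y : R) : 0 <= y -> y <= 1 ->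
  expR (- y) <= 1 - y / 2.
Proof.
move=> y0 y1; rewrite expRN -[leRHS]invrK lef_pV2 ?posrE ?expR_gt0//; last first.
  by rewrite invr_gt0; lra.
apply: le_trans (expR_ge1Dx y).
by rewrite -[leLHS]mul1r ler_pdivrMr; nra.
Qed.

(** Here [q] stands for the probability of staying at size [k]. With q <= 1 - xk/2 the left side is
    at most 1/k - x/(2(k + 1)), a relative loss of (x/2) k/(k + 1) >= x/4. *)
Lemma inv_small_decay (R : realType) n k (x q : R) : (0 < k)%N -> 0 <= x ->
  x * k%:R <= 1 -> q <= expR (- (x * k%:R)) ->
  inv_small R n k.+1 + (inv_small R n k - inv_small R n k.+1) * q <=
    expR (- (x / 4)) * inv_small R n k.
Proof.
move=> k0 x0 xk1 qle.
have K0 : 1 <= k%:R :> R by rewrite ler1n.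
have qhalf : q <= 1 - x * k%:R / 2.
  by apply: le_trans qle _; apply: expRN_le_half => //; rewrite mulr_ge0.
have [kn|kn] := leqP k.*2 n; last first.
  have k1n : (n < (k.+1).*2)%N by rewrite (leq_trans kn)// leq_double.
  by rewrite !inv_small0// subrr mul0r addr0 mulr0.
have a_eq : inv_small R n k = k%:R^-1 by rewrite /inv_small kn.
have ble : inv_small R n k.+1 <= k.+1%:R^-1.
  by rewrite /inv_small; case: ifP.
have e4 : 1 - x / 4 <= expR (- (x / 4)) by exact: expR_ge1Dx.
have q1 : q <= 1.
  have : 0 <= x * k%:R by rewrite mulr_ge0.
  lra.
apply: (@le_trans _ _ ((1 - x / 4) * k%:R^-1)); last first.
  by rewrite a_eq ler_pM2r// invr_gt0; lra.
rewrite a_eq.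
(* As q <= 1, the left side increases with the value at [k.+1]; this also covers the case where that
   size passes half and the value is 0. *)
apply: (@le_trans _ _ (k.+1%:R^-1 + (k%:R^-1 - k.+1%:R^-1) * q)).
  rewrite -subr_ge0; set b := inv_small _ _ _ in ble *.
  rewrite (_ : _ - _ = (k.+1%:R^-1 - b) * (1 - q)); last by ring.
  by rewrite mulr_ge0 ?subr_ge0.
have ab : k%:R^-1 - k.+1%:R^-1 = (k%:R * (1 + k%:R))^-1 :> R.
  by rewrite -natr1; field; apply/andP; split; lra.
rewrite ab -natr1.
apply: (@le_trans _ _ ((k%:R + 1)^-1 + (k%:R * (1 + k%:R))^-1 * (1 - x * k%:R / 2))).
  by rewrite lerD2l ler_pM2l// invr_gt0 mulr_gt0//; lra.
rewrite -subr_ge0.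
rewrite (_ : _ - _ = x * (k%:R - 1) / (4 * k%:R * (1 + k%:R))); last first.
  by field; apply/andP; split; lra.
by rewrite divr_ge0// mulr_ge0//; lra.
Qed.

Lemma integral_sum_indic d (T : measurableType d) (R : realType)
    (mu : {measure set T -> \bar R}) (I : finType) (c : I -> R)
    (E : I -> set T) : (forall i, 0 <= c i) -> (forall i, measurable (E i)) ->
  (\int[mu]_w (\sum_i c i * \1_(E i) w)%:E = \sum_i (c i)%:E * mu (E i))%E.
Proof.
move=> c0 mE; under eq_integral do rewrite -sumEFin.
rewrite ge0_integral_sum//=; last 2 first.
- by move=> i; apply/measurable_EFinP; apply: measurable_funM.
- by move=> i w _; rewrite lee_fin mulr_ge0.
apply: eq_bigr => i _; under eq_integral do rewrite EFinM.
rewrite ge0_integralZl//=; last 2 first.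
- by apply/measurable_EFinP; exact: measurable_indic.
- by rewrite lee_fin.
by rewrite integral_indic// setIT.
Qed.

(** * Lower bounds on cuts in terms of alpha *)

Section cut_parameter.
Context (R : realType) (V : finType) (e : rel V).

Lemma cut_alpha_le (U : {set V}) : U != finset.set0 -> U != [set: V]%SET ->
  cut_alpha R e <= cut_ratio R e U.
Proof.
move=> U0 UT; apply: ge_inf; last by exists U.
by exists 0 => _ [C _ <-]; rewrite divr_ge0.
Qed.

Hypotheses (syme : symmetric e) (conn : forall x y, connect e x y).

Lemma edge_cut_neq0 (U : {set V}) : U != finset.set0 -> U != [set: V]%SET ->
  (0 < #|edge_cut e U|)%N.
Proof.
move=> /finset.set0Pn[x xU]; rewrite -finset.subTset => /subsetPn[y _ yU].
rewrite card_gt0; apply: contra yU => /eqP cut0; rewrite -(_ : x \in U = (y \in U))//.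
apply: closed_connect (conn x y) => a b eab.
have nocut a' b' : e a' b' -> a' \in U -> b' \in U.
  move=> eab' aU; apply/negPn/negP => bU.
  by have := edge_cut_mem eab' aU bU; rewrite cut0 inE.
by apply/idP/idP; apply: nocut => //; rewrite syme.
Qed.

(** By connectedness every cut has an edge, and |U|(n - |U|) is at most n^2, so 1/n^2 bounds all cut
    ratios from below. *)
Lemma cut_alpha_gt0 : (1 < #|V|)%N -> 0 < cut_alpha R e.
Proof.
move=> V1; apply: (@lt_le_trans _ _ ((#|V| * #|V|)%:R^-1)).
  by rewrite invr_gt0 ltr0n muln_gt0 !(ltnW V1).
have [x _] : exists x, x \in V by apply/card_gt0P; exact: ltnW.
apply: lb_le_inf.
  exists (cut_ratio R e [set x]%SET), [set x]%SET => //; split.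
    by apply/finset.set0Pn; exists x; rewrite inE.
  by apply: contraTneq V1 => xT; rewrite -cardsT -xT cards1.
move=> _ [U [U0 UT] <-]; rewrite /cut_ratio.
have cU : (0 < #|U| * (#|V| - #|U|))%N.
  rewrite muln_gt0 card_gt0 U0 subn_gt0 -cardsT proper_card//.
  by rewrite finset.properT.
rewrite (@le_trans _ _ (#|U| * (#|V| - #|U|))%:R^-1)//.
  rewrite lef_pV2 ?posrE ?ltr0n// ?muln_gt0 ?(ltnW V1)// ler_nat.
  by rewrite leq_mul ?max_card ?leq_subr.
rewrite ler_peMl// ler1n; exact: edge_cut_neq0.
Qed.

Lemma edge_cut_ge (U : {set V}) : U != finset.set0 -> (#|U|.*2 <= #|V|)%N ->
  cut_alpha R e * #|V|%:R / 2 * #|U|%:R <= #|edge_cut e U|%:R.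
Proof.
move=> U0 Un; have cU : (0 < #|U|)%N by rewrite card_gt0.
have UT : U != [set: V]%SET.
  by apply: contraTneq Un => ->; rewrite cardsT -ltnNge -addnn;
    rewrite -{1}(addn0 #|V|) ltn_add2l (leq_trans cU)// max_card.
have UV : (#|U| < #|V|)%N by lia.
have := cut_alpha_le U0 UT; rewrite /cut_ratio ler_pdivlMr; last first.
  by rewrite ltr0n muln_gt0 cU subn_gt0.
apply: le_trans; rewrite natrM natrB ?(ltnW UV)//.
have a0 : 0 <= cut_alpha R e by rewrite ltW// cut_alpha_gt0//; lia.
have : #|U|%:R * 2 <= #|V|%:R :> R by rewrite -natrM ler_nat muln2.
move: (ler0n R #|U|).
set k := #|U|%:R; set n := #|V|%:R => k0 kn.
rewrite -subr_ge0 (_ : _ - _ = cut_alpha R e * k * ((n - k * 2) / 2)); last first.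
  by field.
by apply: mulr_ge0; [exact: mulr_ge0|rewrite divr_ge0// subr_ge0].
Qed.

End cut_parameter.

(** * Decay in mean of the inverse ball size *)

Section ball_growth.
Local Open Scope classical_set_scope.
Context (R : realType) (V : finType) (e : rel V).
Hypotheses (syme : symmetric e) (irre : irreflexive e).
Hypothesis conn : forall x y, connect e x y.
Context d (Omega : measurableType d) (P : probability Omega R).
Context (W : {set V} -> {RV P >-> R}).
Hypothesis expW : exp1_edge_weights e W.

Let wt := pos_weight W.
Let wt0 w f (_ : f \in edges e) : 0 <= wt w f. Proof. exact: pos_weight_ge0. Qed.

Lemma ball_eqE u (U : {set V}) s t : 0 <= s -> s <= t ->
  [set w | ball_of e (wt w) u s = U /\ ball_of e (wt w) u t = U] =
  if `[< reachable e u U >] then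
    [set w | settled e (wt w) u U (edge_cut e U) s (fun=> t)] else set0.
Proof.
move=> s0 st; case: asboolP => [rU|nrU]; apply/seteqP; split=> w //=.
- by move=> h; apply/(settled_balls syme irre conn (wt0 w)).
- by move=> h; apply/(settled_balls syme irre conn (wt0 w)).
- by move=> [h _]; apply: nrU; rewrite -h; apply: (ball_reachable conn (wt0 w)).
Qed.

Lemma measurable_ball_eq2 u (U : {set V}) s t : 0 <= s -> s <= t ->
  measurable [set w | ball_of e (wt w) u s = U /\ ball_of e (wt w) u t = U].
Proof.
move=> s0 st; rewrite ball_eqE//; case: asboolP => // _.
apply: (measurable_settled (W := fun f w => wt w f)) => f _.
exact: measurable_maxr.
Qed.

Lemma ball_eq_diag u (U : {set V}) s :
  [set w | ball_of e (wt w) u s = U] =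
  [set w | ball_of e (wt w) u s = U /\ ball_of e (wt w) u s = U].
Proof. by apply/seteqP; split=> w /=; [move=> h; split|case]. Qed.

Lemma measurable_ball_eq u (U : {set V}) s : 0 <= s ->
  measurable [set w | ball_of e (wt w) u s = U].
Proof. by move=> s0; rewrite ball_eq_diag; exact: measurable_ball_eq2. Qed.

Lemma ball_stays_prob u (U : {set V}) s h : 0 <= s -> 0 <= h ->
  P [set w | ball_of e (wt w) u s = U /\ ball_of e (wt w) u (s + h) = U] =
  ((expR (- (#|edge_cut e U|%:R * h)))%:E *
   P [set w | ball_of e (wt w) u s = U])%E.
Proof.
move=> s0 h0; rewrite ball_eq_diag !ball_eqE ?lerDl//.
case: asboolP => _; first exact: settled_prob.
by rewrite measure0 mule0.
Qed.

Lemma ball_mono u w s t : s <= t -> ball_of e (wt w) u s \subset ball_of e (wt w) u t.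
Proof.
by move=> st; apply/fintype.subsetP => x; rewrite !inE => /le_trans; apply.
Qed.

Let phi k := inv_small R #|V| k.

Definition small_ball_mass u s : \bar R :=
  (\int[P]_w (inv_small R #|V| #|ball_of e (wt w) u s|)%:E)%E.

Lemma inv_small_ballE u s w : phi #|ball_of e (wt w) u s| =
  \sum_(U : {set V}) phi #|U| * \1_[set w | ball_of e (wt w) u s = U] w.
Proof.
rewrite (bigD1 (ball_of e (wt w) u s))//= indicE mem_set// mulr1.
rewrite big1 ?addr0// => U UB; rewrite indicE memNset ?mulr0//= => /eqP.
by rewrite eq_sym (negbTE UB).
Qed.

Lemma measurable_inv_small_ball u s : 0 <= s ->
  measurable_fun setT (fun w => phi #|ball_of e (wt w) u s|).
Proof.
move=> s0; under eq_fun do rewrite inv_small_ballE.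
apply: measurable_sum => U; apply: measurable_funM => //.
exact/measurable_indic/measurable_ball_eq.
Qed.

Lemma small_ball_massE u s : 0 <= s -> small_ball_mass u s =
  (\sum_(U : {set V}) (phi #|U|)%:E * P [set w | ball_of e (wt w) u s = U])%E.
Proof.
move=> s0; rewrite /small_ball_mass.
under eq_integral do rewrite -/(phi _) inv_small_ballE.
apply: integral_sum_indic => U; first exact: inv_small_ge0.
exact: measurable_ball_eq.
Qed.

(* From a ball [U] the exploration moves on at rate [#|edge_cut e U|], at least
   proportional to [#|U|], and then [phi] drops by the factor
   [#|U| / (#|U| + 1)]: over a short time [phi] decays exponentially in mean. *)
Lemma small_ball_mass_step u s h : 0 <= s -> 0 <= h ->
  cut_alpha R e * #|V|%:R / 2 * h * #|V|%:R <= 1 -> (1 < #|V|)%N ->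
  (small_ball_mass u (s + h) <=
   (expR (- (cut_alpha R e * #|V|%:R / 2 * h / 4)))%:E * small_ball_mass u s)%E.
Proof.
move=> s0 h0 hV V1; set x := _ / 2 * h.
have a0 := cut_alpha_gt0 R syme conn V1.
have x0 : 0 <= x by rewrite /x !mulr_ge0// ltW.
pose E (U : {set V}) := [set w | ball_of e (wt w) u s = U].
pose F (U : {set V}) :=
  [set w | ball_of e (wt w) u s = U /\ ball_of e (wt w) u (s + h) = U].
have mE U : measurable (E U) by exact: measurable_ball_eq.
have mF U : measurable (F U) by apply: measurable_ball_eq2; rewrite ?lerDl.
(* After time [h] the value is at most that at size |U| + 1, plus the difference to size |U| if the
   ball has not moved: index [true] is the first term, on [E], and [false] the surplus, on [F]. The
   maximum with 0 matters only for empty [U], where [phi 0] is 0 and [phi 1] is 1. *)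
pose c (i : bool * {set V}) : R :=
  if i.1 then phi #|i.2|.+1 else Num.max 0 (phi #|i.2| - phi #|i.2|.+1).
pose G (i : bool * {set V}) := if i.1 then E i.2 else F i.2.
have phiS (U : {set V}) : (0 < #|U|)%N -> phi #|U|.+1 <= phi #|U|.
  by move=> U0; apply: inv_small_anti; rewrite U0 leqnSn.
have bound w : phi #|ball_of e (wt w) u (s + h)| <= \sum_i c i * \1_(G i) w.
  set U := ball_of e (wt w) u s.
  have c0 i : 0 <= c i * \1_(G i) w.
    by rewrite mulr_ge0// /c; case: ifP => _; rewrite ?inv_small_ge0 ?le_max ?lexx.
  have U0 : (0 < #|U|)%N.
    by apply/card_gt0P; exists u; apply: mem_ball_center => //; exact: wt0.
  rewrite (bigD1 (true, U))//= {1}/c/= {1}/G/= indicE mem_set// mulr1.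
  have [UU|UU] := eqVneq (ball_of e (wt w) u (s + h)) U.
    rewrite (bigD1 (false, U))//= {1}/c/= {1}/G/= indicE mem_set// mulr1.
    rewrite max_r ?subr_ge0 ?phiS//.
    by rewrite addrA (addrC (phi #|U|.+1)) subrK UU lerDl sumr_ge0.
  rewrite -[leLHS]addr0 lerD ?sumr_ge0//.
  apply: inv_small_anti => /=; apply: proper_card.
  rewrite finset.properEneq eq_sym UU /= ball_mono// lerDl//.
apply: (@le_trans _ _ (\int[P]_w (\sum_i c i * \1_(G i) w)%:E)%E).
  apply: ge0_le_integral => //=.
  - by move=> w _; rewrite lee_fin inv_small_ge0.
  - by apply/measurable_EFinP/measurable_inv_small_ball; rewrite addr_ge0.
  - apply/measurable_EFinP/measurable_sum => i; apply: measurable_funM => //.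
    by apply: measurable_indic; rewrite /G; case: ifP.
  - by move=> w _; rewrite lee_fin.
rewrite integral_sum_indic; last 2 first.
- by move=> i; rewrite /c; case: ifP => _; rewrite ?inv_small_ge0 ?le_max ?lexx.
- by move=> i; rewrite /G; case: ifP.
rewrite (eq_bigr (fun i => (c (i.1, i.2))%:E * P (G (i.1, i.2))))%E; last by case.
rewrite -(pair_bigA _ (fun b U => (c (b, U))%:E * P (G (b, U))))%E /=.
rewrite big_bool/= -big_split/= small_ball_massE// ge0_sume_distrr; last first.
  by move=> U _; rewrite mule_ge0// lee_fin inv_small_ge0.
apply: lee_sum => U _; rewrite /c/= /G/= /F ball_stays_prob// -/(E U).
have Pfin : P (E U) \is a fin_num by exact: fin_num_measure.
have [U0|U0] := eqVneq U finset.set0.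
  rewrite (_ : E U = set0) ?measure0 ?mule0 ?adde0//.
  apply/seteqP; split=> w //=; rewrite /E /= U0 => ball0.
  have := mem_ball_center (wt0 w) u s0.
  by rewrite ball0 inE.
have cU : (0 < #|U|)%N by rewrite card_gt0.
rewrite -(fineK Pfin) -!EFinM -EFinD lee_fin.
rewrite max_r ?subr_ge0 ?phiS// mulrA -mulrDl mulrA.
apply: ler_wpM2r; first exact: fine_ge0.
have [Un|Un] := leqP #|U|.*2 #|V|; last first.
  have Un1 : (#|V| < #|U|.+1.*2)%N by rewrite (leq_trans Un)// leq_double.
  by rewrite /phi !inv_small0// subrr mul0r addr0 mulr0.
apply: inv_small_decay => //.
- apply: le_trans hV; rewrite -/x ler_wpM2l// ler_nat; exact: max_card.
- rewrite ler_expR lerN2 /x mulrAC ler_wpM2r//.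
  exact: edge_cut_ge.
Qed.

(** The interval from 0 to [s] is cut into [N] equal steps, short enough for [small_ball_mass_step];
    the factors multiply to the rate (alpha n / 2)/4. *)
Lemma small_ball_mass_le u s : 0 <= s -> (1 < #|V|)%N ->
  (small_ball_mass u s <= (expR (- (cut_alpha R e * #|V|%:R / 8 * s)))%:E)%E.
Proof.
move=> s0 V1; have a0 := cut_alpha_gt0 R syme conn V1.
set a := cut_alpha R e in a0 *; set n := #|V|%:R.
have n0 : 0 < n by rewrite ltr0n ltnW.
have iter h N : 0 <= h -> a * n / 2 * h * n <= 1 ->
    (small_ball_mass u (N%:R * h) <= (expR (- (a * n / 2 * (N%:R * h) / 4)))%:E)%E.
  move=> h0 hn; elim: N => [|N IH].
    rewrite !mul0r mulr0 mul0r oppr0 expR0.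
    apply: (@le_trans _ _ (\int[P]_w (cst 1%E) w)%E); last first.
      by rewrite integral_cst// mul1e probability_le1.
    apply: ge0_le_integral => //=.
    - by move=> w _; rewrite lee_fin inv_small_ge0.
    - by apply/measurable_EFinP/measurable_inv_small_ball.
    - by move=> w _; rewrite lee_fin inv_small_le1.
  rewrite -natr1 mulrDl mul1r.
  apply: le_trans (small_ball_mass_step _ _ h0 hn V1) _; first by rewrite mulr_ge0.
  rewrite -/a -/n; apply: le_trans (lee_wpmul2l _ IH) _; first by rewrite lee_fin expR_ge0.
  by rewrite -EFinM -expRD lee_fin ler_expR; lra.
pose N := (Num.bound (a * n / 2 * s * n)).+1.
have N0 : 0 < N%:R :> R by rewrite ltr0n.
have sE : s = N%:R * (s / N%:R) by rewrite mulrC divfK ?gt_eqF.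
have := iter (s / N%:R) N; rewrite -sE.
rewrite (_ : a * n / 2 * s / 4 = a * n / 8 * s); last by field.
apply; first by rewrite divr_ge0// ltW.
rewrite [_ * n](_ : _ = (a * n / 2 * s * n) / N%:R); last by field; rewrite gt_eqF.
rewrite ler_pdivrMr// mul1r (le_trans (ltW (archi_boundP _)))//.
  by rewrite !mulr_ge0// ltW.
by rewrite ler_nat.
Qed.

End ball_growth.

(** * Expected cost *)

Lemma expRN_nat_le (R : realType) i : expR (- i%:R) <= (2 ^+ i)^-1 :> R.
Proof.
elim: i => [|i IH]; first by rewrite oppr0 expR0 expr0 invr1.
rewrite -natr1 opprD expRD exprSr invfM ler_pM ?expR_ge0//.
rewrite expRN lef_pV2 ?posrE ?expR_gt0//.
by apply: le_trans (expR_ge1Dx 1); rewrite -natr1.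
Qed.

Lemma sum_half_le2 (R : realType) N : \sum_(0 <= i < N) (2 ^+ i)^-1 <= 2 :> R.
Proof.
suff -> : \sum_(0 <= i < N) (2 ^+ i)^-1 = 2 - 2 * (2 ^+ N)^-1 :> R.
  by rewrite gerBl mulr_ge0// invr_ge0 exprn_ge0.
elim: N => [|N IH]; first by rewrite big_nil expr0 invr1 mulr1 subrr.
rewrite big_nat_recr//= IH exprS; field.
by rewrite expf_neq0.
Qed.

(* The cost may fail to be measurable, as the run breaks ties arbitrarily; its
   integral is then a lower integral. *)
Lemma integral_le_dominated d (T : measurableType d) (R : realType)
    (mu : {measure set T -> \bar R}) (f g : T -> \bar R) :
  (forall x, (0 <= g x)%E) -> (forall x, (f x <= g x)%E) ->
  (\int[mu]_x f x <= \int[mu]_x g x)%E.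
Proof.
move=> g0 fg; rewrite integralE.
apply: (@le_trans _ _ (\int[mu]_x (f^\+ x))%E).
  by rewrite geeDl// oppe_le0 integral_ge0.
rewrite !ge0_integralTE//; apply: ereal_sup_le => _ [h /= hf <-].
exists h => //= x; apply: le_trans (hf x) _.
by rewrite funeposE ge_max fg g0.
Qed.

Lemma exponential_prob_neg (R : realType) :
  exponential_prob (1 : R) [set x | x < 0]%classic = 0%E.
Proof.
rewrite /exponential_prob; apply: integral0_eq => x /= x0.
by rewrite /exponential_pdf patchE memNset//= in_itv/= andbT leNgt x0.
Qed.

Section greedy_bound.
Context (R : realType) (V : finType) (e : rel V).
Hypotheses (syme : symmetric e) (irre : irreflexive e).
Hypothesis conn : forall x y, connect e x y.
Hypothesis V1 : (1 < #|V|)%N.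
Context d (Omega : measurableType d) (P : probability Omega R).
Context (W : {set V} -> {RV P >-> R}).
Hypothesis expW : exp1_edge_weights e W.

Let n : R := #|V|%:R.
(** Chosen so that (alpha n / 8) [s i] = 2i. The mean of [phi i u] is then at most exp(-2i) <=
    [r i * r i], and [(r i)^-1] serves as the AM-GM parameter m. *)
Let tau : R := 32 / (cut_alpha R e * n).
Let s (i : nat) : R := i%:R * tau / 2.
Let r (i : nat) : R := (2 ^+ i)^-1.
Let neg f : set Omega := [set w | f \in edges e /\ W f w < 0]%classic.
Let phi i u w : R := inv_small R #|V| #|ball_of e (pos_weight W w) u (s i)|.

(* The second sum makes the series diverge on the null event that some weight is
   negative, so that it dominates the cost everywhere. *)
Let dom i w : R := tau / 2 * (n * r i) +
  (\sum_u tau / 2 * (r i)^-1 * phi i u w + \sum_f \1_(neg f) w).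

Let a0 : 0 < cut_alpha R e. Proof. exact: cut_alpha_gt0. Qed.
Let n0 : 0 < n. Proof. by rewrite ltr0n ltnW. Qed.
Let tau0 : 0 < tau. Proof. by rewrite divr_gt0// mulr_gt0. Qed.
Let r0 i : 0 < r i. Proof. by rewrite invr_gt0 exprn_gt0. Qed.
Let s0 i : 0 <= s i. Proof. by rewrite divr_ge0// mulr_ge0// ltW. Qed.

Let coef0 i : 0 <= tau / 2 * (r i)^-1.
Proof. by apply/ltW/mulr_gt0; rewrite ?invr_gt0// divr_gt0. Qed.

Let dom_mass_ge0 i w : 0 <= \sum_u tau / 2 * (r i)^-1 * phi i u w.
Proof. by apply: sumr_ge0 => u _; rewrite mulr_ge0// inv_small_ge0. Qed.

Let dom_neg_ge0 w : 0 <= \sum_f \1_(neg f) w :> R.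
Proof. by apply: sumr_ge0 => f _; rewrite indicE. Qed.

Let cst0 i : 0 <= tau / 2 * (n * r i).
Proof. by apply/ltW/mulr_gt0; [exact: divr_gt0|exact: mulr_gt0]. Qed.

Let dom_ge0 i w : 0 <= dom i w.
Proof. by rewrite /dom !addr_ge0. Qed.

Let measurable_neg f : measurable (neg f).
Proof.
have [fe|fe] := boolP (f \in edges e); last first.
  by rewrite (_ : neg f = set0)//; apply/seteqP; split=> w // -[]; rewrite (negbTE fe).
rewrite (_ : neg f = setT `&` W f @^-1` `]-oo, 0[)%classic.
  exact: (measurable_funP (W f)).
by rewrite setTI; apply/seteqP; split=> w /=; rewrite in_itv/=; [case|split].
Qed.

Let prob_neg f : P (neg f) = 0%E.
Proof.
have [fe|fe] := boolP (f \in edges e); last first.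
  by rewrite (_ : neg f = set0)//; apply/seteqP; split=> w // -[]; rewrite (negbTE fe).
rewrite -(exponential_prob_neg R) -(expW.2 f _ fe); last first.
  rewrite (_ : mkset _ = `]-oo, 0[%classic); first exact: measurable_itv.
  by apply/seteqP; split=> x /=; rewrite in_itv.
rewrite (_ : neg f = W f @^-1` [set x | x < 0])%classic//.
by apply/seteqP; split=> w /=; [case|split].
Qed.

Let measurable_phi i u : measurable_fun setT (phi i u).
Proof. exact: measurable_inv_small_ball. Qed.

Let measurable_dom i : measurable_fun setT (dom i).
Proof.
apply: measurable_funD => //; apply: measurable_funD; apply: measurable_sum => k.
  exact: measurable_funM.
exact: measurable_indic.
Qed.

Let mass_le i u : (\int[P]_w (phi i u w)%:E <= (r i * r i)%:E)%E.
Proof.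
apply: le_trans (small_ball_mass_le syme irre conn expW u (s0 i) V1) _.
rewrite lee_fin (_ : _ * s i = i%:R + i%:R); last first.
  by rewrite /s /tau -/n; field; rewrite !gt_eqF.
by rewrite opprD expRD ler_pM ?expR_ge0// expRN_nat_le.
Qed.

(** The constant term and the [n] mass terms contribute (tau/2) n [r i] each, since
    [(r i)^-1 * (r i * r i)] is [r i]; the null events contribute 0. *)
Let integral_dom i : (\int[P]_w (dom i w)%:E <= (tau * (n * r i))%:E)%E.
Proof.
under eq_integral do rewrite EFinD.
rewrite ge0_integralD//=; last 3 first.
- by move=> w _; rewrite lee_fin cst0.
- by move=> w _; rewrite lee_fin addr_ge0.
- apply/measurable_EFinP; apply: measurable_funD; apply: measurable_sum => k.
    exact: measurable_funM.
  exact: measurable_indic.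
have int_cst c : (\int[P]_w (cst c%:E) w = c%:E)%E.
  by rewrite integral_cst// -[RHS]mule1; congr (_ * _)%E; exact: probability_setT.
rewrite [X in (X + _)%E]int_cst.
under eq_integral do rewrite EFinD.
rewrite ge0_integralD//=; last 4 first.
- by move=> w _; rewrite lee_fin.
- apply/measurable_EFinP; apply: measurable_sum => k.
  exact: measurable_funM.
- by move=> w _; rewrite lee_fin.
- by apply/measurable_EFinP; apply: measurable_sum => k; exact: measurable_indic.
have -> : (\int[P]_w (\sum_f \1_(neg f) w)%:E = 0)%E.
  transitivity (\int[P]_w (\sum_f 1 * \1_(neg f) w)%:E)%E.
    by apply: eq_integral => w _; congr EFin; apply: eq_bigr => f _; rewrite mul1r.
  rewrite (integral_sum_indic P (c := fun=> 1))//.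
  rewrite big1// => f _; rewrite [X in (_ * X)%E](_ : _ = 0%E) ?mule0//.
  exact: prob_neg.
rewrite adde0; under eq_integral do rewrite -sumEFin.
rewrite ge0_integral_sum//=; last 2 first.
- by move=> u; apply/measurable_EFinP; exact: measurable_funM.
- by move=> u w _; rewrite lee_fin mulr_ge0// inv_small_ge0.
apply: (@le_trans _ _ ((tau / 2 * (n * r i))%:E +
    \sum_(u : V) (tau / 2 * (r i)^-1 * (r i * r i))%:E)%E).
  apply: leeD => //; apply: lee_sum => u _.
  under eq_integral do rewrite EFinM.
  rewrite ge0_integralZl//=; last 3 first.
  - exact/measurable_EFinP.
  - by move=> w _; rewrite lee_fin inv_small_ge0.
  - by rewrite lee_fin.
  by rewrite [X in (_ <= X)%E]EFinM lee_wpmul2l// lee_fin.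
rewrite sumEFin -EFinD lee_fin sumr_const -mulr_natr -/n.
by rewrite le_eqVlt; apply/orP; left; apply/eqP; field; rewrite gt_eqF.
Qed.

Lemma matching_cost_dominated w (M : seq (V * V)) :
  greedy_matching (path_metric e (fun f => W f w)) M ->
  exists N, matching_cost (path_metric e (fun f => W f w)) M <=
    \sum_(0 <= i < N) dom i w.
Proof.
move=> greedyM; have [[f [fe fneg]]|nneg] := pselect (exists f, neg f w).
  (* When some weight is negative every [dom i w] is at least 1, so enough terms exceed any finite
     cost. *)
  exists (Num.bound `|matching_cost (path_metric e (fun f => W f w)) M|).
  rewrite (le_trans (ler_norm _))// (le_trans (ltW (archi_boundP _)))//.
  set N := Num.bound _.
  rewrite (_ : N%:R = \sum_(0 <= i < N) 1); last first.
    by rewrite big_const_nat iter_addr addr0 subn0.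
  apply: ler_sum => i _; rewrite /dom.
  rewrite (bigD1 f (F := fun f => \1_(neg f) w))//= [\1_(neg f) w]indicE mem_set//.
  rewrite addrA addrCA lerDl addr_ge0//.
    by rewrite addr_ge0.
  by apply: sumr_ge0 => g _; rewrite indicE.
have W0 f : f \in edges e -> 0 <= W f w.
  by move=> fe; rewrite leNgt; apply/negP => fneg; apply: nneg; exists f.
have Wpos : {in edges e, (fun f => W f w) =1 pos_weight W w}.
  by move=> f fe; rewrite /pos_weight max_r// W0.
have dE := eq_path_metric Wpos.
have pw0 f : f \in edges e -> 0 <= pos_weight W w f.
  by move=> _; exact: pos_weight_ge0.
have [N leN] := matching_cost_le (path_metric e (fun f => W f w)) M tau0.
exists N; apply: le_trans leN _; apply: ler_sum => i _.
have [S [_ sepS cS]] := greedy_run_separated (i%:R * tau) greedyM.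
set c := count _ M in cS *.
have [->|c0] := posnP c; first by rewrite mulr0.
have S1 : (1 < #|S|)%N by move: cS c0; lia.
have sE : s i + s i = i%:R * tau by rewrite /s; field.
have leS : #|S|%:R <= n * r i + (r i)^-1 * \sum_u phi i u w.
  rewrite -{1}(invrK (r i)); apply: separated_card_le => //.
    by rewrite invr_gt0.
  by move=> x y xS yS xy; rewrite sE -dE; exact: sepS.
(* The factor 1/2 comes from [c.*2 <= #|S|]: a pair uses two vertices. *)
apply: (@le_trans _ _ (tau / 2 * (n * r i + (r i)^-1 * \sum_u phi i u w))).
  rewrite -mulrA ler_pM2l// ler_pdivlMl// -natrM.
  by apply: le_trans leS; rewrite ler_nat mul2n.
by rewrite /dom -mulr_sumr mulrDr [tau / 2 * (_^-1 * _)]mulrA addrA lerDl.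
Qed.

(** Monotone convergence exchanges series and integral, and the geometric series gives 2 tau n = 64
    / alpha. *)
Lemma expected_greedy_cost (M : Omega -> seq (V * V)) :
  (forall w, greedy_matching (path_metric e (fun f => W f w)) (M w)) ->
  (\int[P]_w (matching_cost (path_metric e (fun f => W f w)) (M w))%:E <=
    (64 / cut_alpha R e)%:E)%E.
Proof.
move=> greedyM.
pose series_dom w := (\sum_(0 <= i <oo) (dom i w)%:E)%E.
apply: (@le_trans _ _ (\int[P]_w series_dom w)%E).
  apply: integral_le_dominated => w.
    by apply: nneseries_ge0 => i _ _; rewrite lee_fin.
  have [N leN] := matching_cost_dominated (greedyM w).
  apply: (@le_trans _ _ (\sum_(0 <= i < N) (dom i w)%:E)%E).
    by rewrite sumEFin lee_fin.
  by apply: nneseries_lim_ge => i _ _; rewrite lee_fin.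
rewrite integral_nneseries//; last 2 first.
- by move=> i; apply/measurable_EFinP.
- by move=> i w _; rewrite lee_fin.
apply: lime_le.
  apply: is_cvg_nneseries => i _ _.
  by apply: integral_ge0 => w _; rewrite lee_fin.
apply: nearW => N.
apply: (@le_trans _ _ (\sum_(0 <= i < N) (tau * (n * r i))%:E)%E).
  by apply: lee_sum => i _.
rewrite sumEFin lee_fin -2!mulr_sumr.
rewrite (_ : 64 / _ = tau * (n * 2)); last first.
  by rewrite /tau; field; rewrite !gt_eqF.
by rewrite !ler_pM2l// sum_half_le2.
Qed.

End greedy_bound.

Theorem theorem2 (R : realType) :
  exists2 C : R, 0 < C &
  forall (V : finType) (e : rel V),
    simple_graph e -> connected_graph e -> ~~ odd #|V| ->
  forall (dO : measure_display) (Omega : measurableType dO)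
    (P : probability Omega R) (W : {set V} -> {RV P >-> R}),
    exp1_edge_weights e W ->
  let d (omega : Omega) : V -> V -> R := path_metric e (fun f => W f omega) in
  forall M : Omega -> seq (V * V),
    (forall omega, greedy_matching (d omega) (M omega)) ->
  let GR (omega : Omega) : R := matching_cost (d omega) (M omega) in
  ('E_P[GR] <= (C / cut_alpha R e)%:E)%E.
Proof.
exists 64; first by [].
move=> V e [syme irre] [V0 conn] evenV dO Omega P W expW d M greedyM.
(* Positive and even means at least 2, which makes alpha positive. *)
have V1 : (1 < #|V|)%N by case: #|V| V0 evenV => [|[]].
rewrite /= unlock; exact: expected_greedy_cost greedyM.
Qed.
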